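(* There exists a topological dynamical system $(X,T)$ which is minimal, weakly mixing, and an almost HY-system.
   Context: A topological dynamical system (t.d.s.) is a pair $(X,T)$ with $X$ a compact metric space and $T:X\to X$ a continuous surjective map. $\mathbb{N}=\{1,2,\dots\}$ and $\mathbb{Z}_+=\mathbb{N}\cup\{0\}$. $(X,T)$ is minimal if for every $x\in X$ the orbit $\{x,Tx,T^2x,\dots\}$ is dense in $X$. $(X,T)$ is transitive if for all non-empty open $U,V\subset X$ the set $N(U,V)=\{n\in\mathbb{Z}_+: T^{-n}V\cap U\ne\emptyset\}$ is infinite; totally transitive if $(X,T^n)$ is transitive for every $n\in\mathbb{N}$; weakly mixing if $(X\times X,T\times T)$ is transitive. $M(X)$ is the space of Borel probability measures on $X$ with the weak$^*$-topology, and $T_M:M(X)\to M(X)$ is $(T_M\mu)(A)=\mu(T^{-1}A)$ for Borel $A\subset X$. $(X,T)$ has almost dense periodic sets if for each non-empty open $U\subset X$ and $\epsilon>0$ there are $k\in\mathbb{N}$ and $\mu\in M(X)$ with $T_M^k\mu=\mu$ such that $\mu(X\setminus U)<\epsilon$. An almost HY-system is a totally transitive t.d.s. having almost dense periodic sets. *)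

(* Defs.v *)
From HB Require Import structures.
From mathcomp Require Import all_boot all_order all_algebra.
From mathcomp Require Import all_classical all_reals all_analysis.

Set Implicit Arguments.
Unset Strict Implicit.
Unset Printing Implicit Defensive.

Import Order.TTheory GRing.Theory Num.Theory.

Local Open Scope classical_set_scope.
Local Open Scope ring_scope.

(* The library's measurable types are pointed, so the phase space comes with a
   distinguished point, on which nothing below depends; for a non-empty space
   this is no restriction. *)
#[short(type="pmetricType")]
HB.structure Definition PMetric (K : numDomainType) :=
  {M of Pointed M & Metric K M}.

Definition tds (R : realType) (X : metricType R) (T : X -> X) : Prop :=
  [/\ compact [set: X], continuous T & set_surj [set: X] [set: X] T].

Definition minimal (X : topologicalType) (T : X -> X) : Prop :=
  forall x : X, dense (range (fun n : nat => iter n T x)).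

Definition hitting_times (X : topologicalType) (T : X -> X) (U V : set X) :
    set nat :=
  [set n : nat | iter n T @^-1` V `&` U !=set0].

Definition transitive_system (X : topologicalType) (T : X -> X) : Prop :=
  forall U V : set X, open U -> U !=set0 -> open V -> V !=set0 ->
    infinite_set (hitting_times T U V).

Definition totally_transitive (X : topologicalType) (T : X -> X) : Prop :=
  forall n : nat, (0 < n)%N -> transitive_system (iter n T).

Definition weakly_mixing (X : topologicalType) (T : X -> X) : Prop :=
  transitive_system (fun p : X * X => (T p.1, T p.2)).

Definition borel (X : ptopologicalType) := g_sigma_algebraType (@open X).

(* A measure of the library is a function on all subsets of the carrier, whose
   values outside the sigma-algebra are irrelevant: elements of M(X) are
   therefore compared on Borel sets only. *)
Definition same_measure (R : realType) (X : ptopologicalType)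
    (mu nu : set (borel X) -> \bar R) : Prop :=
  forall A : set (borel X), measurable A -> mu A = nu A.

Definition induced_map (R : realType) (X : ptopologicalType) (T : X -> X)
    (mu : set (borel X) -> \bar R) : set (borel X) -> \bar R :=
  pushforward mu (T : borel X -> borel X).

Definition almost_dense_periodic_sets (R : realType) (X : pmetricType R)
    (T : X -> X) : Prop :=
  forall (U : set X) (e : R), open U -> U !=set0 -> 0 < e ->
    exists (k : nat) (mu : probability (borel X) R),
      [/\ (0 < k)%N,
          same_measure (iter k (induced_map T) mu) mu &
          (mu (~` U) < e%:E)%E].

Definition almost_HY_system (R : realType) (X : pmetricType R) (T : X -> X) :
    Prop :=
  [/\ tds T, totally_transitive T & almost_dense_periodic_sets T].

Definition nontrivial_space (X : Type) : Prop := exists x y : X, x <> y.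

(* Main.v *)
Require Import Defs.
From HB Require Import structures.
From mathcomp Require Import all_boot all_order all_algebra.
From mathcomp Require Import all_classical all_reals all_analysis.
From mathcomp Require Import finmap zify lra.

(* The system is the one-sided subshift generated by a rank-two word [x], the
   limit of words A_n of length L_n built together with words C_n of length
   L_n + 1 as A_(n+1) = A_n C_n^(L_n) A_n^(P-1) and
   C_(n+1) = A_n C_n^(L_n+1) A_n^(P-2), with P much larger than L_n.  Every word
   of stage n + 1 starts with A_n, whence minimality.  Choosing how many of the
   crossed words are C_n's, one finds two copies of A_(n-1) at any distance t
   with L_n^2 <= t < (P-1) L_n, so any two open sets meet at all times of long
   intervals; this gives weak mixing and total transitivity.  Nevertheless A_n
   starts at all multiples of L_n in x outside a set of density at most
   2^(1-n): averaging along the orbit of T^(L_n) gives, by a limit along an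
   ultrafilter, a T^(L_n)-invariant measure almost concentrated on [A_n]. *)

Set Implicit Arguments.
Unset Strict Implicit.
Unset Printing Implicit Defensive.

Import Order.TTheory GRing.Theory Num.Theory.
Import numFieldNormedType.Exports.

(** * The word *)

(* At stage [n] there are two words [A = blk n false] and [C = blk n true], of
   lengths [len n] and [len n + 1]; stage [n + 1] has
   [A' = A C^L A^(P-1)] and [C' = A C^(L+1) A^(P-2)] with [L = len n] and
   [P = 2^n (L + 1)].  Taking [L] copies of [C] keeps the length of [A'] a
   multiple of [L]. *)
Fixpoint len (n : nat) : nat :=
  if n is m.+1 then (2 ^ m + 1) * (len m).+1 * len m else 1.

Definition subst_word (n : nat) (b : bool) : seq bool :=
  false :: nseq (len n + b) true ++ nseq (2 ^ n * (len n).+1 - 1 - b) false.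

Fixpoint blk (n : nat) (b : bool) : seq bool :=
  if n is m.+1 then flatten [seq blk m c | c <- subst_word m b]
  else false :: nseq b true.

Lemma ltn_len n : n < len n.
Proof.
elim: n => //= n IH; rewrite mulnDl mulnDl.
have : 0 < 2 ^ n by rewrite expn_gt0.
nia.
Qed.

Lemma len_gt0 n : 0 < len n.
Proof. exact: leq_ltn_trans (ltn_len n). Qed.

Lemma size_flatten_blk n bs : (forall b, size (blk n b) = len n + b) ->
  size (flatten (map (blk n) bs)) = len n * size bs + count id bs.
Proof.
move=> sz; elim: bs => [|b bs IH]; first by rewrite muln0.
rewrite /= size_cat IH sz; lia.
Qed.

(** This gives P >= 2, so the truncated subtraction of [1] and [b] in [subst_word] is exact. *)
Lemma exp_len_ge2 n : 2 <= 2 ^ n * (len n).+1.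
Proof.
have := len_gt0 n; have : 0 < 2 ^ n by rewrite expn_gt0.
nia.
Qed.

Lemma size_subst_word n b : size (subst_word n b) = len n + 2 ^ n * (len n).+1.
Proof.
rewrite /= size_cat !size_nseq; have := exp_len_ge2 n; case: b; lia.
Qed.

Lemma size_blk n b : size (blk n b) = len n + b.
Proof.
elim: n b => [|n IH] b; first by rewrite /= size_nseq.
rewrite (size_flatten_blk (subst_word n b) IH) size_subst_word.
rewrite /= count_cat !count_nseq /= mul1n mul0n; nia.
Qed.

Lemma size_blks n bs :
  size (flatten (map (blk n) bs)) = len n * size bs + count id bs.
Proof. by apply: size_flatten_blk => b; apply: size_blk. Qed.

Lemma blkSE n b : blk n.+1 b = flatten (map (blk n) (subst_word n b)).
Proof. by []. Qed.

Lemma prefix_blk n d : prefix (blk n false) (blk (n + d) false).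
Proof.
elim: d => [|d IH]; first by rewrite addn0 prefix_refl.
by apply: prefix_trans IH _; rewrite addnS blkSE /subst_word /= prefix_prefix.
Qed.

(* [blk i false] is longer than [i] and is a prefix of all later [A]-words, so
   this is the limit of the [A]-words. *)
Definition word (i : nat) : bool := nth false (blk i false) i.

Lemma wordE n i : i < len n -> word i = nth false (blk n false) i.
Proof.
move=> ilen; rewrite /word; have [le_in|lt_ni] := leqP i n.
- have /prefixP[s] := prefix_blk i (n - i); rewrite subnKC // => ->.
  by rewrite nth_cat size_blk addn0 ltn_len.
- have /prefixP[s] := prefix_blk n (i - n); rewrite (subnKC (ltnW lt_ni)) => ->.
  by rewrite nth_cat size_blk addn0 ilen.
Qed.

(** * Occurrences of the blocks in the word *)

Definition appears (w : seq bool) (i : nat) :=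
  forall j, j < size w -> word (i + j) = nth false w j.

Definition occ (n i : nat) : bool :=
  [forall j : 'I_(len n), word (i + j) == word j].

Lemma occP n i : reflect (forall j, j < len n -> word (i + j) = word j) (occ n i).
Proof.
apply: (iffP forallP) => [H j jn|H j]; first exact: (eqP (H (Ordinal jn))).
by rewrite H.
Qed.

Lemma appears_cat u v i :
  appears (u ++ v) i -> appears u i /\ appears v (i + size u).
Proof.
move=> H; split=> j jn; first by rewrite H ?nth_cat ?jn // size_cat; lia.
by rewrite -addnA H ?size_cat ?ltn_add2l // nth_cat ltnNge leq_addr /= addKn.
Qed.

Lemma appears_blk0 n : appears (blk n false) 0.
Proof. by move=> j; rewrite size_blk addn0 => /wordE ->. Qed.

Lemma appears_occ n i : appears (blk n false) i -> occ n i.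
Proof.
move=> H; apply/occP => j jn; rewrite H ?size_blk ?addn0 //.
by rewrite -wordE.
Qed.

Lemma appears_occS n b i : appears (blk n.+1 b) i -> occ n i.
Proof. by rewrite blkSE /subst_word /= => /appears_cat[/appears_occ]. Qed.

(** Each word before the [j]-th takes [len n] letters, and each [blk n true] among them one more. *)
Lemma appears_nth n bs i j : j < size bs ->
  appears (flatten (map (blk n) bs)) i ->
  appears (blk n (nth false bs j)) (i + (len n * j + count id (take j bs))).
Proof.
move=> jbs; rewrite -{1}(cat_take_drop j bs) map_cat flatten_cat.
move=> /appears_cat[_]; rewrite (drop_nth false) //= => /appears_cat[+ _].
by rewrite size_blks size_take jbs.
Qed.

Lemma blk_blks n d b : exists bs, blk (n + d) b = flatten (map (blk n) bs).
Proof.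
elim: d b => [|d IH] b; first by exists [:: b]; rewrite addn0 /= cats0.
rewrite addnS blkSE; elim: (subst_word _ b) => [|c s [bs bsE]]; first by exists [::].
by have [cs csE] := IH c; exists (cs ++ bs); rewrite map_cat flatten_cat -bsE -csE.
Qed.

Lemma blks_locate n bs i : i < size (flatten (map (blk n) bs)) ->
  exists2 j, j < size bs &
    len n * j + count id (take j bs) <= i
      < len n * j + count id (take j bs) + (len n).+1.
Proof.
elim: bs i => //= b bs IH i; rewrite size_cat size_blk => ilt.
case: (ltnP i (len n + b)) => ib.
  by exists 0; rewrite // take0 muln0 /=; case: b {ilt} ib; lia.
have [|j jbs] := IH (i - (len n + b)); first lia.
by exists j.+1; rewrite //= mulnS; lia.
Qed.

(** Both words of stage n + 1 start with A_n and have at most [G] letters, so the one covering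
    position [i + G] starts after [i]. *)
Lemma occ_recurrent n i : exists2 g, g <= (len n.+1).+1 & occ n (i + g).
Proof.
set G := (len n.+1).+1.
have [bs bsE] := blk_blks n.+1 (i + G) false.
have Gi : i + G < size (flatten (map (blk n.+1) bs)).
  by rewrite -bsE size_blk; have := ltn_len (n.+1 + (i + G)); lia.
have [j jbs /andP[le_ji lt_ij]] := blks_locate Gi.
have := @appears_blk0 (n.+1 + (i + G)); rewrite bsE => /(appears_nth jbs).
move=> /appears_occS; set p := (0 + _) => op.
by exists (p - i); rewrite ?subnKC //; rewrite /p /G in lt_ij *; lia.
Qed.

Lemma count_take_subst_word n (b : bool) j : j <= len n + b ->
  count id (take j.+1 (subst_word n b)) = j.
Proof.
move=> jn; rewrite /= take_cat size_nseq; case: ltnP => jn'.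
  by rewrite take_nseq 1?ltnW // count_nseq mul1n.
have -> : j = len n + b by lia.
by rewrite subnn take0 cats0 count_nseq mul1n.
Qed.

Lemma count_take_subst_word_end n (b : bool) j : len n + b <= j ->
  count id (take j.+1 (subst_word n b)) = len n + b.
Proof.
move=> jn; rewrite /= take_cat size_nseq ltnNge jn /= count_cat count_nseq mul1n.
rewrite [count _ _](_ : _ = 0) ?addn0 //; apply/eqP; rewrite eqn0Ngt -has_count.
by apply/hasPn => c /mem_take; rewrite mem_nseq => /andP[_ /eqP ->].
Qed.

(* From inside the run [C^L] of stage [n + 2] to a later copy of [A] one crosses
   [c] words, [r] of which are [C], for any [r <= L] and [r <= c < r + P - 1];
   this covers the time [t = c L + r]. *)
Lemma occ_differences n t :
  len n.+1 ^ 2 <= t < (2 ^ n.+1 * (len n.+1).+1 - 1) * len n.+1 ->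
  exists2 i, occ n i & occ n (i + t).
Proof.
(* Both words of stage [m] start with A_n, so it only matters where such words start, not which of
   them stands there. *)
move: n.+1 (@appears_occS n) => m H /andP[t1 t2].
have A := @appears_blk0 m.+1; rewrite blkSE in A.
have m0 := len_gt0 m; have P2 := exp_len_ge2 m.
have tE := divn_eq t (len m); have rL := ltn_pmod t m0.
move: (t %/ len m) (t %% len m) tE rL => c r tE rL.
have cL : len m <= c by rewrite leqNgt; apply/negP => ?; nia.
have cP : c < 2 ^ m * (len m).+1 - 1 by rewrite ltnNge; apply/negP => ?; nia.
(* With L = [len m], starting at index L - r + 1 leaves exactly [r] copies of C to cross; as c >= L
   > r, the index L - r + 1 + c is past the run. *)
have := @appears_nth m (subst_word m false) 0 (len m - r).+1.
rewrite count_take_subst_word ?addn0 ?leq_subr // size_subst_word add0n => /(_ _ A)/H i1.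
have := @appears_nth m (subst_word m false) 0 (len m - r + c).+1.
rewrite count_take_subst_word_end ?addn0; last lia.
rewrite size_subst_word add0n => /(_ _ A)/H i2.
eexists; first apply: i1; first lia.
move: i2; set p := len m * _ + _; set q := (_ + t).
have -> : q = p by rewrite /q /p tE; nia.
by apply; lia.
Qed.

(** * Density of the multiples of [len n] where A_n does not start *)

Fixpoint ratio (n d : nat) : nat :=
  if d is e.+1 then (2 ^ (n + e) + 1) * (len (n + e)).+1 * ratio n e else 1.

Lemma len_ratio n d : len (n + d) = ratio n d * len n.
Proof.
by elim: d => [|d IH]; rewrite ?addn0 ?mul1n // addnS /= {2}IH mulnA.
Qed.

Lemma ltn_ratio n d : d < ratio n d.
Proof.
elim: d => //= d IH; have := len_gt0 (n + d).
have : 0 < 2 ^ (n + d) by rewrite expn_gt0.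
rewrite mulnDl mulnDl; nia.
Qed.

(** As [ratio n d] is the quotient of [len (n + d)] by [len n], the sum runs over the multiples of
    [len n] inside the initial A_(n+d). *)
Definition misses (n d : nat) : nat :=
  \sum_(0 <= i < ratio n d) ~~ occ n (i * len n).

Lemma sum_blocks (F : nat -> nat) K M :
  \sum_(0 <= i < K * M) F i = \sum_(0 <= k < K) \sum_(0 <= i < M) F (k * M + i).
Proof.
elim: K => [|K IH]; first by rewrite mul0n !big_geq.
rewrite big_nat_recr //= -IH mulSn addnC.
rewrite (@big_cat_nat _ _ _ (K * M)) ?leq_addr //=; congr (_ + _).
rewrite -{1}[K * M]add0n big_addn addKn.
by apply: eq_bigr => i _; rewrite addnC.
Qed.

Lemma sum_bool_le (F : nat -> bool) M : \sum_(0 <= i < M) F i <= M.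
Proof.
apply: (@leq_trans (\sum_(0 <= i < M) 1)); last first.
  by rewrite sum_nat_const_nat subn0 muln1.
by apply: leq_sum => i _; apply: leq_b1.
Qed.

(** The L copies of C delay the later words by L letters, one whole word length; so after the run
    words start at multiples of L again, the one of index k - 1 at k L. *)
Lemma occ_multiple m k : k < (2 ^ m + 1) * (len m).+1 ->
  (k == 0) || (len m + 1 < k) -> occ m (k * len m).
Proof.
move=> kK /orP[/eqP ->|Lk]; first exact/appears_occ/appears_blk0.
have A := @appears_blk0 m.+1; rewrite blkSE in A.
have := @appears_nth m (subst_word m false) 0 k.-1.
have kE : k.-1 = k.-2.+1 by lia.
rewrite {4}kE count_take_subst_word_end ?addn0; last lia.
rewrite size_subst_word => /(_ _ A).
have -> : nth false (subst_word m false) k.-1 = false.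
  rewrite kE /= nth_cat size_nseq ltnNge.
  by rewrite (_ : len m + 0 <= k.-2) ?nth_nseq ?if_same //; lia.
have -> : 0 + (len m * k.-1 + len m) = k * len m by nia.
by move=> H; apply/appears_occ/H; nia.
Qed.

(** The copy of A_(n+d) at [k] repeats the initial one, and [i < ratio n d] keeps the tested window
    inside it. *)
Lemma occ_shift n d k i : i < ratio n d -> occ (n + d) k ->
  occ n (k + i * len n) = occ n (i * len n).
Proof.
move=> ilt /occP ok; apply: eq_forallb => j /=.
have il : i * len n + j < len (n + d).
  by rewrite len_ratio; have := ltn_ord j; nia.
by rewrite -addnA ok.
Qed.

(* Only the [L + 1] multiples of [L] following the initial [A] of [A'] can fail
   to start a copy of [A]. *)
Lemma misses_step n d :
  misses n d.+1 <= (2 ^ (n + d) + 1) * (len (n + d)).+1 * misses n d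
                    + (len (n + d)).+1 * ratio n d.
Proof.
rewrite /misses [ratio n d.+1]/=; set m := n + d.
set K := (_ * (len m).+1); set M := ratio n d; set B := misses n d.
rewrite sum_blocks.
(* Blocks with k = 0 or k > [len m + 1] repeat the first one and have [B] misses; the others are
   bounded trivially by their size [M]. *)
apply: (@leq_trans (\sum_(0 <= k < K) (B + ((0 < k) && (k <= len m + 1)) * M))).
  rewrite big_nat [leqRHS]big_nat; apply: leq_sum => k /andP[_ kK].
  have [kb|] := boolP ((k == 0) || (len m + 1 < k)).
    rewrite (_ : (0 < k) && (k <= len m + 1) = false); last by lia.
    rewrite mul0n addn0 leq_eqVlt; apply/orP; left; apply/eqP.
    rewrite big_nat [RHS]big_nat; apply: eq_bigr => i /andP[_ iM].
    by rewrite mulnDl -mulnA -len_ratio (@occ_shift n d) // occ_multiple.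
  rewrite negb_or -leqNgt -lt0n => ->; rewrite mul1n.
  apply: leq_trans (leq_addl _ _).
  exact: sum_bool_le.
rewrite big_split /= sum_nat_const_nat subn0 leq_add2l -big_distrl /= leq_mul2r.
apply/orP; right; rewrite (@big_cat_nat _ _ _ (len m).+2) //=; last first.
  have : 0 < 2 ^ m * (len m).+1 by rewrite muln_gt0 expn_gt0.
  by rewrite /K mulnDl mul1n; lia.
rewrite [X in _ + X]big_nat [X in _ + X]big1 ?addn0; last by move=> k; lia.
by rewrite big_nat_recl //= add0n sum_bool_le.
Qed.

(** Passing from stage n + d to the next adds a proportion of misses below 2^(-n-d), and these sum
    to at most 2^(1-n). The induction [H] carries the partial sum 2^(1-n) - 2^(1-n-d), cleared of
    denominators. *)
Lemma misses_le n d : 2 ^ n * misses n d <= 2 * ratio n d.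
Proof.
suff H : 2 ^ (n + d) * misses n d + 2 * ratio n d <= 2 ^ d.+1 * ratio n d.
  rewrite -(@leq_pmul2l (2 ^ d)) ?expn_gt0 //; move: H.
  rewrite expnD expnS; nia.
elim: d => [|d IH].
  have -> : misses n 0 = 0.
    rewrite /misses big_nat1 mul0n; apply/eqP; rewrite eqb0 negbK.
    exact/appears_occ/appears_blk0.
  by rewrite muln0.
have := misses_step n d; rewrite [ratio n d.+1]/= (addnS n d).
move: (misses n d.+1) (misses n d) (ratio n d) IH => b' b M.
move: (len _) => L IH st.
rewrite [2 ^ (n + d).+1]expnS [2 ^ d.+2]expnS.
move: (2 ^ (n + d)) (2 ^ d.+1) IH st => p q IH st.
set K := (p + 1) * L.+1 in st *.
have : 2 * p * b' <= 2 * p * (K * b + L.+1 * M) by rewrite leq_mul2l st orbT.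
have : K * (p * b + 2 * M) <= K * (q * M) by rewrite leq_mul2l IH orbT.
have : p * L.+1 * M <= K * M by rewrite leq_mul2r /K mulnDl leq_addr orbT.
by move=> ? ? ?; nia.
Qed.

Local Open Scope classical_set_scope.
Local Open Scope ring_scope.

(** * The subshift generated by a sequence *)

Definition agree (n : nat) (y z : nat -> bool) : Prop :=
  forall j, (j < n)%N -> y j = z j.

Definition tail (i : nat) (y : nat -> bool) : nat -> bool := fun j => y (i + j)%N.

(* The parameter [R] is a phantom that fixes the field of values of the metric. *)
Record hull (R : realType) (x : nat -> bool) := Hull {
  hull_seq :> nat -> bool;
  hullP : forall n, exists i, agree n hull_seq (tail i x) }.

HB.instance Definition _ (R : realType) x := gen_eqMixin (hull R x).
HB.instance Definition _ (R : realType) x := gen_choiceMixin (hull R x).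

(** * The metric of the first difference *)

Section hull_metric.
Context {R : realType} {x : nat -> bool}.
Implicit Types y z : hull R x.

Lemma hull_inj y z : y =1 z -> y = z.
Proof.
case: y z => [y yP] [z zP] /= /funext yz; subst z.
by congr Hull; exact: Prop_irrelevance.
Qed.

Definition first_diff_dist (y z : hull R x) : R :=
  if pselect (exists n, y n != z n) is left h then (ex_minn h).+1%:R^-1 else 0.

Lemma first_diff_dist_ge y z n :
  y n != z n -> n.+1%:R^-1 <= first_diff_dist y z.
Proof.
rewrite /first_diff_dist; case: pselect => [h yz|h yz]; last by case: h; exists n.
by case: ex_minnP => m _ /(_ _ yz) mn; rewrite lef_pV2 ?posrE ?ltr0n // ler_nat ltnS.
Qed.

Lemma first_diff_dist_lt y z n :
  first_diff_dist y z < n.+1%:R^-1 <-> agree n.+1 y z.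
Proof.
split=> [yz j jn|yz].
  apply/eqP/negPn/negP => /first_diff_dist_ge /le_lt_trans/(_ yz).
  by rewrite ltf_pV2 ?posrE ?ltr0n // ltr_nat ltnNge jn.
rewrite /first_diff_dist; case: pselect => [h|_]; last by rewrite invr_gt0 ltr0n.
case: ex_minnP => m ym _; rewrite ltf_pV2 ?posrE ?ltr0n // ltr_nat ltnS.
by rewrite ltnNge; apply/negP => mn; case/eqP: ym; apply: yz; rewrite ltnS.
Qed.

Lemma first_diff_distxx y : first_diff_dist y y = 0.
Proof.
by rewrite /first_diff_dist; case: pselect => // h; exfalso; case: h => n; rewrite eqxx.
Qed.

Lemma first_diff_dist_positivity y z : first_diff_dist y z = 0 -> y = z.
Proof.
move=> yz; apply: hull_inj => n; apply/eqP/negPn/negP => /first_diff_dist_ge.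
by rewrite yz leNgt invr_gt0 ltr0n.
Qed.

Lemma first_diff_dist_sym y z : first_diff_dist y z = first_diff_dist z y.
Proof.
suff le u v : first_diff_dist u v <= first_diff_dist v u.
  by apply/le_anti; rewrite !le.
rewrite {1}/first_diff_dist; case: pselect => [h|_].
  case: ex_minnP => m; rewrite eq_sym => vu _; exact: first_diff_dist_ge.
by rewrite /first_diff_dist; case: pselect => // ?; rewrite invr_ge0.
Qed.

(** At the first index where [y] and [y'] differ, [z] differs from one of them, and that distance
    alone bounds the left side. *)
Lemma first_diff_dist_triangle z y y' :
  first_diff_dist y y' <= first_diff_dist y z + first_diff_dist z y'.
Proof.
have dist_ge0 u v : 0 <= first_diff_dist u v.
  by rewrite /first_diff_dist; case: pselect => // ?; rewrite invr_ge0.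
rewrite {1}/first_diff_dist; case: pselect => [h|_]; last by rewrite addr_ge0.
case: ex_minnP => n yy' _; have [yz|/first_diff_dist_ge yz] := eqVneq (y n) (z n).
  rewrite yz in yy'; apply: le_trans (first_diff_dist_ge yy') _.
  by rewrite lerDr dist_ge0.
by rewrite (le_trans yz) // lerDl.
Qed.

End hull_metric.

HB.instance Definition _ (R : realType) x := isMetric.Build R (hull R x)
  (@first_diff_distxx R x) (@first_diff_dist_positivity R x)
  (@first_diff_dist_sym R x) (@first_diff_dist_triangle R x).

Lemma hull_point_subproof (x : nat -> bool) n : exists i, agree n x (tail i x).
Proof. by exists 0. Qed.

HB.instance Definition _ (R : realType) x := isPointed.Build (hull R x)
  (Hull R (hull_point_subproof x)).

(** * Cylinders, compactness and the shift *)

Section hull_topology.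
Context {R : realType} {x : nat -> bool}.
Implicit Types (y z : hull R x) (A : set (hull R x)).

Lemma nbhs_hullP y A : nbhs y A <-> exists n, forall z, agree n y z -> A z.
Proof.
split.
  move=> /nbhs_ballP[e /= e0 yA].
  have [n ne] : exists n : nat, n.+1%:R^-1 < e.
    exists (Num.truncn e^-1); rewrite invf_plt ?posrE ?ltr0n //.
    by rewrite truncnS_gt.
  exists n.+1 => z yz; apply: yA; rewrite ballEmdist /=.
  by apply: lt_trans ne; apply/first_diff_dist_lt.
move=> [n nA]; apply/nbhs_ballP; exists n.+1%:R^-1; first by rewrite /= invr_gt0.
move=> z; rewrite ballEmdist /= => /first_diff_dist_lt yz.
by apply: nA => j jn; apply: yz; rewrite ltnW.
Qed.

Lemma open_hullP A :
  open A <-> forall y, A y -> exists n, forall z, agree n y z -> A z.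
Proof.
rewrite openE; split=> H y Ay; first by apply/nbhs_hullP/H.
by apply/nbhs_hullP/H.
Qed.

Lemma clopen_agree n (w : nat -> bool) : clopen [set y : hull R x | agree n w y].
Proof.
split; first by apply/open_hullP => y wy; exists n => z yz j jn; rewrite wy ?yz.
rewrite -openC; apply/open_hullP => y wy; exists n => z yz wz.
by apply: wy => j jn; rewrite wz ?yz.
Qed.

(** An ultrafilter decides every letter; the resulting sequence [y] is in the hull because each of
    its prefixes is shared by a point of the hull. *)
Lemma compact_hull : compact [set: hull R x].
Proof.
rewrite compact_ultra => F FU _.
pose y (j : nat) : bool := `[< F [set z : hull R x | z j] >].
have Fy j : F [set z : hull R x | z j = y j].
  rewrite /y; case: asboolP => [//|nF].
  have [//|] := in_ultra_setVsetC [set z : hull R x | z j] FU.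
  by apply: filterS => z /= /negP/negbTE.
have Fagree n : F [set z : hull R x | agree n y z].
  elim: n => [|n IH]; first by apply: filterS filterT => z _ j.
  apply: filterS (filterI IH (Fy n)) => z [yz zn] j.
  by rewrite ltnS leq_eqVlt => /orP[/eqP ->|/yz].
have yP n : exists i, agree n y (tail i x).
  have [z yz] := filter_ex (Fagree n); have [i zi] := hullP z n.
  by exists i => j jn; rewrite yz // zi.
exists (Hull R yP); split=> // A /nbhs_hullP[n nA].
by apply: filterS (Fagree n) => z; apply: nA.
Qed.

Lemma shift_subproof y n : exists i, agree n (tail 1 y) (tail i x).
Proof.
have [i yi] := hullP y n.+1; exists i.+1 => j jn.
by rewrite /tail add1n yi // /tail addnS.
Qed.

Definition hull_shift y : hull R x := Hull R (shift_subproof y).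

Lemma iter_shiftE k y j : iter k hull_shift y j = y (k + j)%N.
Proof. by elim: k j => //= k IH j; rewrite /tail add1n IH addnS. Qed.

Lemma continuous_iter_shift k : continuous (iter k hull_shift).
Proof.
move=> y A /nbhs_hullP[n nA]; apply/nbhs_hullP; exists (k + n)%N => z yz.
by apply: nA => j jn; rewrite !iter_shiftE yz ?ltn_add2l.
Qed.

(** This reduces questions on open sets to copies of prefixes of [x]: a cylinder inside [U] is read
    in [x] at some position [i], hence entered [i] steps after a long enough copy of the beginning
    of [x]. *)
Lemma hull_base U : open U -> U !=set0 ->
  exists i n, exists C : set (hull R x), [/\ clopen C, C `<=` U &
    forall y : hull R x, agree n x y -> C (iter i hull_shift y)].
Proof.
move=> /open_hullP oU [z /oU[n zU]]; have [i zi] := hullP z n.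
exists i, (i + n)%N, [set y : hull R x | agree n z y]; split.
- exact: clopen_agree.
- exact: zU.
- by move=> y xy j jn; rewrite iter_shiftE zi // /tail xy // ltn_add2l.
Qed.

(** There are countably many finite words, so an open set is a countable union of cylinders. *)
Lemma open_sub_sigma_clopen : @open (hull R x) `<=` <<s @clopen (hull R x) >>.
Proof.
move=> U /open_hullP oU.
pose D := [set w : seq bool |
  [set y : hull R x | agree (size w) (nth false w) y] `<=` U].
(* The default [[::]] for codes of no word is harmless: only words in [D] enter the union. *)
pose w i := odflt [::] (choice.unpickle i) : seq bool.
have -> : U = \bigcup_(i in [set i | D (w i)])
    [set y : hull R x | agree (size (w i)) (nth false (w i)) y].
  apply/seteqP; split=> [y Uy|y [i /= wD]]; last exact: wD.
  have [n nU] := oU y Uy; exists (choice.pickle (mkseq y n)); rewrite /= /w choice.pickleK /=.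
    move=> z /=; rewrite /agree size_mkseq => yz; apply: nU => j jn.
    by rewrite -yz // nth_mkseq.
  by move=> j; rewrite size_mkseq => jn; rewrite nth_mkseq.
apply: (@bigcup_measurable _ (g_sigma_algebraType (@clopen (hull R x)))).
by move=> i _; apply: sub_sigma_algebra; exact: clopen_agree.
Qed.

End hull_topology.

(** * Invariant measures *)

(** A copy of the space whose measurable sets are the clopen ones, the domain from which a content
    is extended. *)
Definition clopen_algebra (X : ptopologicalType) : Type := X.

HB.instance Definition _ (X : ptopologicalType) :=
  Pointed.on (clopen_algebra X).
HB.instance Definition _ (X : ptopologicalType) :=
  isAlgebraOfSets.Build default_measure_display (clopen_algebra X)
    (@clopen0 X) (@clopenU X) (fun A cA => @clopenC X A A cA).

Section clopen_extension.
Context {R : realType} {X : ptopologicalType}.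
Hypothesis compX : compact [set: X].
Hypothesis open_sigma_clopen : @open X `<=` <<s @clopen X >>.
Variable m : set X -> R.
Hypothesis m_ge0 : forall A, 0 <= m A.
Hypothesis m_setT : m setT = 1.
Hypothesis m_setU : forall A B, A `&` B = set0 -> m (A `|` B) = m A + m B.

Let c : set (clopen_algebra X) -> \bar R := fun A => (m A)%:E.

Let m_set0 : m set0 = 0.
Proof.
have := m_setU (setI0 set0); rewrite setU0 => /eqP.
by rewrite -subr_eq subrr eq_sym => /eqP.
Qed.

Let c_ge0 A : (0 <= c A)%E. Proof. by rewrite lee_fin. Qed.

Let c_semi_additive : measure_function.semi_additive c.
Proof.
apply/additive2P; first by rewrite /c m_set0.
by move=> A B _ _ AB; rewrite /c m_setU // EFinD.
Qed.

HB.instance Definition _ := isContent.Build _ _ R c c_ge0 c_semi_additive.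

(* A countable clopen cover of a clopen set has a finite subcover, so that finite
   additivity suffices. *)
Let c_sigma_subadditive : measurable_subset_sigma_subadditive c.
Proof.
move=> A F Fm Am AF.
have : compact (A : set X) by apply: subclosed_compact compX _; first exact: Am.2.
rewrite compact_cover => /(_ _ setT F)[|//|D _ AD]; first by move=> i _; exact: (Fm i).1.
have Dfin : finite_set [set` D] by exact: finite_fset.
apply: (le_trans (@content_sub_fsum _ _ _ c _ _ _ _ Dfin (fun i _ => Fm i) Am AD)).
rewrite nneseries_esum //; apply: esum_ge; exists [set` D] => //.
Qed.

HB.instance Definition _ := Content_SigmaSubAdditive_isMeasure.Build _ _ _
  c c_sigma_subadditive.

(** The extension lives on the sigma-algebra generated by the clopen sets; [borel_clopen] allows
    reading it on Borel sets. *)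
Let nu (A : set (borel X)) : \bar R := measure_extension c A.

Let borel_clopen (A : set X) : <<s @open X >> A -> <<s @clopen X >> A.
Proof. by apply: smallest_sub => //; exact: smallest_sigma_algebra. Qed.

Let nu0 : nu set0 = 0%E. Proof. exact: measure0. Qed.

Let nu_ge0 A : (0 <= nu A)%E. Proof. exact: measure_ge0. Qed.

Let nu_semi_sigma_additive : semi_sigma_additive nu.
Proof.
move=> F mF tF mUF.
apply: (@measure_semi_sigma_additive _ _ _ (measure_extension c)) => //.
  by move=> i; exact: borel_clopen (mF i).
exact: borel_clopen mUF.
Qed.

HB.instance Definition _ := isMeasure.Build _ (borel X) R nu
  nu0 nu_ge0 nu_semi_sigma_additive.

Let nu_clopen A : clopen A -> nu A = (m A)%:E.
Proof. by move=> cA; rewrite /nu /measure_extension measurable_mu_extE. Qed.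

Let nu_setT : nu setT = 1%E.
Proof. by rewrite nu_clopen ?m_setT //; exact: clopenT. Qed.

HB.instance Definition _ := Measure_isProbability.Build _ (borel X) R nu nu_setT.

Lemma clopen_extension : exists mu : probability (borel X) R,
  forall A : set X, clopen A -> mu A = (m A)%:E.
Proof. by exists nu. Qed.

End clopen_extension.

(** The clopen sets are stable under intersection and generate the Borel sigma-algebra. *)
Lemma borel_measure_unique (R : realType) (X : ptopologicalType)
    (m1 m2 : {measure set (borel X) -> \bar R}) :
  @open X `<=` <<s @clopen X >> -> (m1 setT < +oo)%E ->
  (forall A : set X, clopen A -> m1 A = m2 A) -> same_measure m1 m2.
Proof.
move=> oc fin m12 A mA.
apply: (@measure_unique _ R (borel X) (@clopen X) (fun=> setT) _ _ _ _ m1 m2) => //.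
- apply/seteqP; split=> B.
    by apply: smallest_sub => //; exact: smallest_sigma_algebra.
  apply: smallest_sub; first exact: smallest_sigma_algebra.
  by move=> C /= cC; apply: sub_sigma_algebra; exact: cC.1.
- exact: clopenI.
- by move=> _; exact: clopenT.
- by rewrite bigcup_const.
Qed.

(** Compactness gives a cluster point, and an ultrafilter converges to its cluster points. *)
Lemma ultra_cvg_itv01 (R : realType) (T : Type) (G : set_system T) (f : T -> R) :
  UltraFilter G -> (forall t, 0 <= f t <= 1) -> cvg (f @ G).
Proof.
move=> GU f01; have := @segment_compact R 0 1; move=> /(_ (f @ G) _) [].
  suff : G (f @^-1` `[0, 1]) by [].
  by apply: filterS filterT => t _; rewrite /= in_itv /= f01.
move=> p [_ clp]; apply/cvg_ex; exists p => B pB.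
have [//|GB] := in_ultra_setVsetC (f @^-1` B) GU.
by have [y []] := clp (~` B) B GB pB.
Qed.

(** * Visit frequencies along an orbit *)

Section visit_frequency.
Context {R : realType} {X : ptopologicalType}.
Variables (S : X -> X) (x0 : X) (M : nat -> nat).
Hypothesis M_gt : forall d, (d < M d)%N.

Definition visits (A : set X) (n : nat) : nat :=
  \sum_(0 <= i < n) `[< A (iter i S x0) >].

Definition freq (A : set X) (d : nat) : R := (visits A (M d))%:R / (M d)%:R.

Let M_gt0 d : (0 : R) < (M d)%:R.
Proof. by rewrite ltr0n; apply: leq_ltn_trans (M_gt d). Qed.

Lemma visits_le A n : (visits A n <= n)%N.
Proof. exact: (sum_bool_le (fun i => `[< A (iter i S x0) >])). Qed.

Lemma freq_itv01 A d : 0 <= freq A d <= 1.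
Proof.
by rewrite divr_ge0 // ler_pdivrMr // mul1r ler_nat visits_le.
Qed.

Lemma freq_setT d : freq setT d = 1.
Proof.
rewrite /freq /visits; under eq_bigr do rewrite asboolT //.
by rewrite sum_nat_const_nat subn0 muln1 divff // gt_eqF.
Qed.

Lemma freq_setU A B d : A `&` B = set0 -> freq (A `|` B) d = freq A d + freq B d.
Proof.
move=> AB; rewrite /freq -mulrDl -natrD /visits -big_split /=.
congr (_%:R / _); apply: eq_bigr => i _.
have nAB : A (iter i S x0) -> B (iter i S x0) -> False.
  by move=> Ay By; have : (A `&` B) (iter i S x0) by []; rewrite AB.
by do 3![case: asboolP => ? //]; exfalso; tauto.
Qed.

(** The two visit counts differ only by the terms at times 0 and [M d], hence by at most 1, and
    [M d] exceeds [d]. *)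
Lemma freq_preimage A d : `|freq (S @^-1` A) d - freq A d| <= d.+1%:R^-1.
Proof.
rewrite /freq -mulrBl normrM normfV normr_nat.
apply: (@le_trans _ _ (M d)%:R^-1); last first.
  by rewrite lef_pV2 ?posrE ?M_gt0 ?ltr0n // ler_nat M_gt.
rewrite ler_piMl ?invr_ge0 //.
have /(congr1 (fun n => n%:R : R)) : (visits (S @^-1` A) (M d) + `[< A x0 >]
    = visits A (M d) + `[< A (iter (M d) S x0) >])%N.
  by rewrite /visits -(@big_nat_recr _ _ _ (M d) 0) //= big_nat_recl //= addnC.
rewrite !natrD; do 2!case: asboolP => _ /=; rewrite ?addr0 => E; rewrite ler_norml;
  by apply/andP; split; lra.
Qed.

End visit_frequency.

(* The limit of the visit frequencies along an ultrafilter is a finitely additive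
   invariant set function on all subsets; its restriction to clopen sets extends
   to a measure. *)
Lemma krylov_bogoliubov (R : realType) (X : ptopologicalType) (S : X -> X) (x0 : X)
    (M : nat -> nat) :
  compact [set: X] -> @open X `<=` <<s @clopen X >> -> continuous S ->
  (forall d, (d < M d)%N) ->
  exists mu : probability (borel X) R, same_measure (induced_map S mu) mu /\
    forall (C : set X) r, clopen C -> (forall d, r <= freq S x0 M C d) ->
      (r%:E <= mu C)%E.
Proof.
move=> compX oX contS ltM.
have [G [GU sG]] := @ultraFilterLemma nat \oo _.
pose m (A : set X) : R := lim (freq S x0 M A @ G).
have cm A : freq S x0 M A @ G --> m A.
  by apply: ultra_cvg_itv01 => d; exact: freq_itv01.
have m_ge0 A : 0 <= m A.
  apply: (cvgr_to_ge (cm A)); apply: filterS filterT => d _.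
  by have /andP[] := freq_itv01 (R := R) S x0 ltM A d.
have m_setT : m setT = 1.
  apply: cvg_lim => //; apply: cvg_near_cst; apply: filterS filterT => d _.
  exact: freq_setT.
have m_setU A B : A `&` B = set0 -> m (A `|` B) = m A + m B.
  move=> AB; apply: cvg_lim => //.
  rewrite (_ : freq S x0 M (A `|` B) = freq S x0 M A \+ freq S x0 M B); last first.
    by apply/funext => d; rewrite /= freq_setU.
  exact: cvgD.
have m_inv A : m (S @^-1` A) = m A.
  (* Since [G] refines the filter at infinity, the bound of [freq_preimage], which tends to 0,
     forces the two limits to agree. *)
  apply/eqP; rewrite -subr_eq0 -normr_le0; apply/ler_addgt0Pr => e e0; rewrite add0r.
  have cmA : (fun d => `|freq S x0 M (S @^-1` A) d - freq S x0 M A d|) @ G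
      --> `|m (S @^-1` A) - m A|.
    by apply: cvg_norm; exact: cvgB (cm _) (cm _).
  apply: (cvgr_to_le cmA); apply: sG.
  near=> d; apply: le_trans (freq_preimage S x0 ltM A d) _.
  apply: ltW; near: d; exact: (near_infty_natSinv_lt (PosNum e0)).
have [mu muE] := clopen_extension compX oX m_ge0 m_setT m_setU.
exists mu; split; last first.
  move=> C r cC rC; rewrite muE // lee_fin; apply: (cvgr_to_ge (cm C)).
  by apply: filterS filterT.
have mS : measurable_fun setT (S : borel X -> borel X).
  apply: measurability => // _ [B oB <-]; rewrite setTI.
  by apply: sub_sigma_algebra; move/continuousP: contS; apply.
apply: (borel_measure_unique oX).
  by rewrite /= /pushforward preimage_setT probability_setT ltry.
move=> A cA; rewrite /= /pushforward !muE ?m_inv //.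
exact: preimage_clopen.
Unshelve. all: by end_near.
Qed.

(** * The system *)

Lemma unbounded_infinite (A : set nat) :
  (forall m, exists2 t, A t & (m < t)%N) -> infinite_set A.
Proof.
move=> unb /finite_seqP[s As]; have [t At] := unb (\max_(i <- s) i).
rewrite ltnNge (bigmaxn_sup_seq t) //.
by move: At; rewrite As.
Qed.

(** Otherwise the complement of the compact range of [T] is a non-empty open set that the orbit of
    [T p] never meets. *)
Lemma minimal_surj (R : realType) (X : metricType R) (T : X -> X) (p : X) :
  compact [set: X] -> continuous T -> minimal T -> set_surj setT setT T.
Proof.
move=> compX contT minT; apply: contrapT => nsurj.
have clT : closed (range T).
  apply: compact_closed; first exact: metric_hausdorff.
  by apply: continuous_compact compX; exact: continuous_subspaceT.
have [z nTz] : exists z, (~` range T) z.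
  apply: contrapT => nz; apply: nsurj => z _; apply: contrapT => nTz.
  by apply: nz; exists z.
have [y [nTy [n _ yE]]] := minT (T p) (~` range T) (ex_intro _ z nTz) (closed_openC clT).
by apply: nTy; rewrite -yE -iterSr iterS; exists (iter n T p).
Qed.

Lemma iter_pair (X Y : Type) (f : X -> X) (g : Y -> Y) n p :
  iter n (fun q : X * Y => (f q.1, g q.2)) p = (iter n f p.1, iter n g p.2).
Proof. by elim: n => [|n IH]; [case: p | rewrite !iterS IH]. Qed.

Lemma open_prod_box (X Y : topologicalType) (W : set (X * Y)) :
  open W -> W !=set0 -> exists U V, [/\ open U, U !=set0, open V, V !=set0 &
    forall x y, U x -> V y -> W (x, y)].
Proof.
move=> oW [[x y] Wxy]; have : nbhs (x, y) W by exact: open_nbhs_nbhs.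
move=> [[A B] /= [xA yB] AB].
exists (interior A), (interior B); split; try exact: open_interior.
- by exists x.
- by exists y.
- by move=> u v Au Bv; apply: AB; split; exact: interior_subset.
Qed.

(** * Dynamics of the subshift generated by [word] *)

Section substitution_system.
Context {R : realType}.
Local Notation X := (hull R word).
Local Notation T := (@hull_shift R word).
Local Notation base := (Hull R (hull_point_subproof word)).

Lemma occ_agree n m i : (m <= n)%N -> occ n i ->
  agree m word (iter i T base).
Proof.
move=> mn /occP oi j jm; rewrite iter_shiftE /= oi //.
by have := ltn_len n; lia.
Qed.

(** The interval of times depends on [n] alone and only the threshold [n0] on the open sets, so
    several pairs of open sets share hitting times. *)
Lemma shift_hits (U V : set X) : open U -> U !=set0 -> open V -> V !=set0 ->
  exists n0, forall n t, (n0 <= n)%N ->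
    (len n.+1 * len n.+1 + len n.+1 <= t < 2 * (len n.+1 * len n.+1))%N ->
    hitting_times T U V t.
Proof.
move=> oU U0 oV V0.
have [i1 [n1 [C1 [_ CU U1]]]] := hull_base oU U0.
have [i2 [n2 [C2 [_ CV V2]]]] := hull_base oV V0.
exists (i1 + i2 + n1 + n2)%N => n t le_n t_itv.
have i_lt : (i1 + i2 < len n.+1)%N by have := ltn_len n.+1; lia.
(* The copies must be [t + i1 - i2] apart, as [U] and [V] are entered [i1] and [i2] steps after
   them; the margins of the interval absorb this correction. *)
have [|a oa oas] := @occ_differences n (t + i1 - i2)%N.
  have : (2 <= 2 ^ n.+1)%N by rewrite expnS leq_pmulr // expn_gt0.
  rewrite -mulnn; move: (2 ^ n.+1)%N (len n.+1) t_itv i_lt => p L; nia.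
pose p : X := base.
exists (iter i1 T (iter a T p)); split; last first.
  by apply/CU/U1/(occ_agree _ oa); lia.
rewrite /preimage /= -!iterD.
have -> : (t + i1 + a = i2 + (a + (t + i1 - i2)))%N by lia.
by rewrite iterD; apply/CV/V2/(occ_agree _ oas); lia.
Qed.

Lemma shift_minimal : minimal T.
Proof.
move=> y U U0 oU; have [i [n [C [_ CU UC]]]] := hull_base oU U0.
(* This length leaves room for the gap of [occ_recurrent] and then [n] letters of A_n. *)
have [a ya] := hullP y ((len n.+1).+1 + n).
have [g gG og] := occ_recurrent n a.
exists (iter i T (iter g T y)); split; last by exists (i + g)%N => //; rewrite iterD.
apply/CU/UC => j jn; rewrite iter_shiftE ya /tail ?addnA; last by lia.
by move/occP: og => ->; rewrite // (ltn_trans jn) // ltn_len.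
Qed.

Lemma shift_weakly_mixing : weakly_mixing T.
Proof.
move=> U V oU U0 oV V0.
have [U1 [U2 [oU1 U10 oU2 U20 UU]]] := open_prod_box oU U0.
have [V1 [V2 [oV1 V10 oV2 V20 VV]]] := open_prod_box oV V0.
have [n1 hit1] := shift_hits oU1 U10 oV1 V10.
have [n2 hit2] := shift_hits oU2 U20 oV2 V20.
apply: unbounded_infinite => m; pose n := (n1 + n2 + m)%N.
have Ln := ltn_len n.+1; have L2 : (2 <= len n.+1)%N by lia.
(* The first time of the interval of stage [n] serves both pairs; [L2] makes the interval
   non-empty. *)
exists (len n.+1 * len n.+1 + len n.+1)%N; last by rewrite /n in Ln *; lia.
have t_itv : (len n.+1 * len n.+1 + len n.+1 <= len n.+1 * len n.+1 + len n.+1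
              < 2 * (len n.+1 * len n.+1))%N.
  by apply/andP; split => //; rewrite /n in Ln L2 *; nia.
have [|x [xV xU]] := hit1 n _ _ t_itv; first by rewrite /n; lia.
have [|y [yV yU]] := hit2 n _ _ t_itv; first by rewrite /n; lia.
by exists (x, y); split; [rewrite /preimage /= iter_pair; exact: VV|exact: UU].
Qed.

Lemma shift_totally_transitive : totally_transitive T.
Proof.
move=> k k0 U V oU U0 oV V0; have [n0 hit] := shift_hits oU U0 oV V0.
apply: unbounded_infinite => m; pose n := (n0 + m + k)%N.
have Ln := ltn_len n.+1; pose Q := (len n.+1 * len n.+1 + len n.+1)%N.
have QE := divn_eq Q k; have rk := ltn_pmod Q k0.
(* This gives the least multiple of [k] above [Q], still in the interval, which is longer than [k]
   because [n >= k]. *)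
exists (Q %/ k).+1; last first.
  by rewrite ltnS leq_divRL //; rewrite /Q /n in Ln *; nia.
rewrite /hitting_times /= (_ : iter _ (iter k T) = iter ((Q %/ k).+1 * k) T).
  apply: (hit n); first by rewrite /n; lia.
  by rewrite -/Q mulSn; apply/andP; split; first lia; rewrite /Q /n in QE rk Ln *; nia.
by apply/funext => y; rewrite iterM.
Qed.

(** Each multiple of [len n] where A_n starts yields a visit to [C]; the remaining ones are counted
    by [misses]. *)
Lemma visits_word n (C : set X) i m d : (m <= n)%N ->
  (forall y : X, agree m word y -> C (iter i T y)) ->
  (ratio n d <= visits (iter (len n) T)
                  (iter i T base) C (ratio n d)
                + misses n d)%N.
Proof.
move=> mn UC; rewrite /visits /misses -big_split /=.
apply: (@leq_trans (\sum_(0 <= j < ratio n d) 1)).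
  by rewrite sum_nat_const_nat subn0 muln1.
apply: leq_sum => j _; case: (boolP (occ n (j * len n))) => [oj|_]; last by rewrite addn1.
rewrite addn0 asboolT //; rewrite -iterM -iterD addnC iterD.
by apply/UC/(occ_agree mn oj).
Qed.

Lemma shift_almost_dense_periodic_sets : almost_dense_periodic_sets (X := X) T.
Proof.
move=> U e oU U0 e0; have [i [m [C [clC CU UC]]]] := hull_base oU U0.
have [n mn en] : exists2 n, (m <= n)%N & 2 / (2 ^ n)%:R < e.
  exists (m + Num.truncn (2 / e))%N; first exact: leq_addr.
  rewrite ltr_pdivrMr ?ltr0n ?expn_gt0 // mulrC -ltr_pdivrMr //.
  apply: (lt_le_trans (truncnS_gt _)); rewrite ler_nat.
  by apply: leq_trans (ltn_expl _ _); rewrite // ltnS leq_addl.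
(* The orbit starts [i] steps after [base] because [C] is entered [i] steps after a copy of A_n. *)
have [mu [muT muC]] := @krylov_bogoliubov R X (iter (len n) T)
  (iter i T base) (ratio n)
  compact_hull (@open_sub_sigma_clopen R word) (@continuous_iter_shift R word _)
  (ltn_ratio n).
exists (len n), mu; split; first exact: len_gt0.
  move=> A mA; rewrite -[RHS]muT //.
  have -> // : forall k, iter k (induced_map T) mu = induced_map (iter k T) mu.
  by elim=> //= k ->.
have : ((1 - 2 / (2 ^ n)%:R)%:E <= mu C)%E.
  apply: muC => // d; rewrite /freq ler_pdivlMr ?ltr0n; last first.
    exact: leq_ltn_trans (ltn_ratio n d).
  have := visits_word d mn UC; have := misses_le n d.
  rewrite -(ler_nat R) natrM natrM => mis; rewrite -(ler_nat R) natrD => vis.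
  rewrite mulrBl mul1r lerBlDr (le_trans vis) // lerD2l mulrAC ler_pdivlMr.
    by rewrite mulrC.
  by rewrite ltr0n expn_gt0.
move=> muC_ge; have mC : measurable (C : set (borel X)).
  by apply: sub_sigma_algebra; exact: clC.1.
have mU : measurable (U : set (borel X)) by exact: sub_sigma_algebra.
rewrite probability_setC //.
have : (mu C <= mu U)%E.
  by apply: (@le_measure _ R (borel X) mu) => //; exact: mem_set.
move=> /(le_trans muC_ge); rewrite -(fineK (fin_num_measure mu U mU)).
by rewrite lee_fin -EFinB lte_fin; lra.
Qed.

End substitution_system.

Theorem theorem4p11 (R : realType) :
  exists (X : pmetricType R) (T : X -> X),
    [/\ nontrivial_space X, tds T, minimal T, weakly_mixing T
      & almost_HY_system T].
Proof.
pose p := Hull R (hull_point_subproof word).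
have contT : continuous (@hull_shift R word) by exact: (@continuous_iter_shift R word 1).
have tdsT : tds (@hull_shift R word).
  split=> //; first exact: compact_hull.
  by apply: (minimal_surj p) => //; [exact: compact_hull|exact: shift_minimal].
exists (hull R word), (@hull_shift R word); split=> //.
(* The word begins with [false], [false], [true], so its letters 0 and 2 differ. *)
- exists p, (iter 2 (@hull_shift R word) p) => /(congr1 (fun y : hull R word => y 0)).
  by rewrite iter_shiftE.
- exact: shift_minimal.
- exact: shift_weakly_mixing.
- split=> //; first exact: shift_totally_transitive.
  exact: shift_almost_dense_periodic_sets.
Qed.
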